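(* For any 1-cell $\frac{\alpha}{\theta}\colon\frac{X}{G}\to\frac{Y}{H}$ in $\mathbb{S}$, there is an adjoint triplet $$\Big(\frac{\alpha}{\theta}\Big)_{+}\dashv\Big(\frac{\alpha}{\theta}\Big)^{*}\dashv\Big(\frac{\alpha}{\theta}\Big)_{\bullet},$$ i.e. the functor $(\frac{\alpha}{\theta})_+\colon{}_G\mathrm{set}/X\to{}_H\mathrm{set}/Y$ is left adjoint to $(\frac{\alpha}{\theta})^*\colon{}_H\mathrm{set}/Y\to{}_G\mathrm{set}/X$, and the functor $(\frac{\alpha}{\theta})_\bullet\colon{}_G\mathrm{set}/X\to{}_H\mathrm{set}/Y$ is right adjoint to $(\frac{\alpha}{\theta})^*$.
   Context: For a finite group $G$, ${}_G\mathrm{set}$ is the category of finite $G$-sets and $G$-maps; objects of the slice category ${}_G\mathrm{set}/X$ are written $(A,\mathfrak{a})$ with $\mathfrak{a}\colon A\to X$ a $G$-map. 0-cells and 1-cells of $\mathbb{S}$. A 0-cell is a pair of a finite group $G$ and a finite $G$-set $X$, denoted $\frac{X}{G}$ (a formal symbol). A 1-cell $\frac{\alpha}{\theta}\colon\frac{X}{G}\to\frac{Y}{H}$ is a pair of a map $\alpha\colon X\to Y$ and a family of maps $\theta=\{\theta_x\colon G\to H\}_{x\in X}$ with $\alpha(gx)=\theta_x(g)\alpha(x)$ and $\theta_x(gg')=\theta_{g'x}(g)\theta_x(g')$ for all $x\in X$, $g,g'\in G$. Fix a 1-cell $\frac{\alpha}{\theta}\colon\frac{X}{G}\to\frac{Y}{H}$.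 $(\frac{\alpha}{\theta})^*$ sends $(B,\mathfrak{b})$ to the set $X\times_YB=\{(x,b)\mid\alpha(x)=\mathfrak{b}(b)\}$ with $G$-action $g(x,b)=(gx,\theta_x(g)b)$ and the projection to $X$, and sends a morphism $f$ to $(x,b)\mapsto(x,f(b))$. For $(A,\mathfrak{a})\in{}_G\mathrm{set}/X$, let $H\times_GA=(H\times A)/\sim$, where $(\eta,a)\sim(\eta',a')$ iff there is $g\in G$ with $a'=ga$ and $\eta=\eta'\theta_{\mathfrak{a}(a)}(g)$; the class of $(\eta,a)$ is $[\eta,a]$ and $H$ acts by $h[\eta,a]=[h\eta,a]$. For $(A,\mathfrak{a})=(X,\mathrm{id}_X)$ put $\mathrm{SIm}(\frac{\alpha}{\theta})=H\times_GX$, and let $\widetilde{\alpha}\colon\mathrm{SIm}(\frac{\alpha}{\theta})\to Y$ be the $H$-map $[\eta,x]\mapsto\eta\alpha(x)$. The functor $S_\theta\colon{}_G\mathrm{set}/X\to{}_H\mathrm{set}/\mathrm{SIm}(\frac{\alpha}{\theta})$ sends $(A,\mathfrak{a})$ to $H\times_GA\to H\times_GX$, $[\eta,a]\mapsto[\eta,\mathfrak{a}(a)]$, and $f$ to $[\eta,a]\mapsto[\eta,f(a)]$. The functor $(\frac{\alpha}{\theta})_+$ is $S_\theta$ followed by composition with $\widetilde{\alpha}$. The endofunctor $(-)^\theta$ of ${}_G\mathrm{set}/X$ sends $(A,\mathfrak{a})$ to $(A^\theta,\mathfrak{a}|_{A^\theta})$, where $A^\theta\subseteq A$ is the $G$-subset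 of those $a\in A$ such that for all $g,g'\in G$: if $\theta_{\mathfrak{a}(a)}(g)=\theta_{\mathfrak{a}(a)}(g')$ and $g\mathfrak{a}(a)=g'\mathfrak{a}(a)$, then $ga=g'a$. It sends a morphism $f$ to its restriction $f|_{A^\theta}$. For an $H$-map $f\colon W\to Y$, the functor $\Pi_f\colon{}_H\mathrm{set}/W\to{}_H\mathrm{set}/Y$ sends $(B,\mathfrak{b})$ to the set $\Pi_f(B)$ of pairs $(y,\sigma)$ with $y\in Y$ and $\sigma\colon f^{-1}(y)\to B$ a map such that $\mathfrak{b}\circ\sigma$ is the inclusion $f^{-1}(y)\hookrightarrow W$, with $H$-action $h(y,\sigma)=(hy,{}^h\sigma)$, ${}^h\sigma(w)=h\sigma(h^{-1}w)$, and with the projection to $Y$; it sends a morphism $k$ to $(y,\sigma)\mapsto(y,k\circ\sigma)$. The functor $(\frac{\alpha}{\theta})_\bullet$ is the composition $\Pi_{\widetilde{\alpha}}\circ S_\theta\circ(-)^\theta\colon{}_G\mathrm{set}/X\to{}_H\mathrm{set}/Y$. *)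

(* Defs.v *)
From HB Require Import structures.
From mathcomp Require Import all_boot fingroup generic_quotient.

Set Implicit Arguments.
Unset Strict Implicit.
Unset Printing Implicit Defensive.

Local Open Scope group_scope.
Local Open Scope quotient_scope.

Record category := Category {
  obj :> Type;
  hom : obj -> obj -> Type;
  idm : forall A, hom A A;
  comp : forall A B C, hom B C -> hom A B -> hom A C;
  comp1m : forall A B (f : hom A B), comp (idm B) f = f;
  compm1 : forall A B (f : hom A B), comp f (idm A) = f;
  compA : forall A B C D (h : hom C D) (g : hom B C) (f : hom A B),
    comp h (comp g f) = comp (comp h g) f }.

Record functor (C D : category) := Functor {
  fobj :> C -> D;
  fmap : forall A B : C, hom A B -> hom (fobj A) (fobj B);
  fmap1 : forall A : C, fmap (idm A) = idm (fobj A);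
  fmapM : forall (A B E : C) (g : hom B E) (f : hom A B),
    fmap (comp g f) = comp (fmap g) (fmap f) }.

Arguments idm {c} A.
Arguments comp {c A B C} g f : rename.
Arguments fmap {C D} F {A B} f : rename.

Section FunctorComp.
Variables (C D E : category) (K : functor D E) (F : functor C D).

Fact functor_comp1 (A : C) : fmap K (fmap F (idm A)) = idm (K (F A)).
Proof. by rewrite !fmap1. Qed.

Fact functor_compM (A B B' : C) (g : hom B B') (f : hom A B) :
  fmap K (fmap F (comp g f)) = comp (fmap K (fmap F g)) (fmap K (fmap F f)).
Proof. by rewrite !fmapM. Qed.

Definition functor_comp : functor C E := Functor functor_comp1 functor_compM.

End FunctorComp.

(* An adjunction F -| K, as a family of bijections Hom(F c, d) -> Hom(c, K d)
   natural in c and d. *)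
Record adjunction (C D : category) (F : functor C D) (K : functor D C) :=
  Adjunction {
    adj_hom : forall (c : C) (d : D), hom (F c) d -> hom c (K d);
    adj_bij : forall (c : C) (d : D), bijective (@adj_hom c d);
    adj_nat : forall (c c' : C) (d d' : D)
                     (h : hom c' c) (u : hom (F c) d) (k : hom d d'),
      adj_hom (comp k (comp u (fmap F h)))
      = comp (fmap K k) (comp (adj_hom u) h) }.

Definition left_adjoint_to (C D : category) (F : functor C D)
  (K : functor D C) : Prop := inhabited (adjunction F K).

(* The actions of MathComp's action.v are right actions, hence this record
   for left ones. *)
Record gset (G : finGroupType) := GSet {
  gcarrier :> finType;
  gact : G -> gcarrier -> gcarrier;
  gact1 : forall x, gact 1 x = x;
  gactM : forall (g g' : G) x, gact (g * g') x = gact g (gact g' x) }.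

Arguments gact {G X} g x : rename.
Notation "g ** x" := (gact g x) (at level 38, right associativity).

(* G-maps are finite functions with a boolean equivariance condition, so that
   Leibniz equality of G-maps is pointwise equality. *)
Definition equivariant (G : finGroupType) (X Y : gset G)
    (f : {ffun X -> Y}) : bool :=
  [forall g : G, forall x : X, f (g ** x) == g ** f x].

Record gmap (G : finGroupType) (X Y : gset G) := GMap {
  gfun :> {ffun X -> Y};
  _ : equivariant gfun }.

HB.instance Definition _ (G : finGroupType) (X Y : gset G) :=
  [isSub for @gfun G X Y].
HB.instance Definition _ (G : finGroupType) (X Y : gset G) :=
  [Equality of gmap X Y by <:].

Section GMaps.
Variable G : finGroupType.

Lemma gmapE (X Y : gset G) (f : gmap X Y) g x : f (g ** x) = g ** f x.
Proof. by case: f => f /= /forallP/(_ g)/forallP/(_ x)/eqP. Qed.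

Lemma gmap_eq (X Y : gset G) (f f' : gmap X Y) : f =1 f' -> f = f'.
Proof. by move=> ff'; apply/val_inj/ffunP. Qed.

Fact mk_gmap_subproof (X Y : gset G) (f : X -> Y) :
  (forall g x, f (g ** x) = g ** f x) -> equivariant (finfun f).
Proof.
by move=> fP; apply/forallP=> g; apply/forallP=> x; rewrite !ffunE fP.
Qed.

Definition mk_gmap (X Y : gset G) (f : X -> Y)
    (fP : forall g x, f (g ** x) = g ** f x) : gmap X Y :=
  GMap (mk_gmap_subproof fP).

Lemma mk_gmapE (X Y : gset G) (f : X -> Y) fP x : @mk_gmap X Y f fP x = f x.
Proof. by rewrite ffunE. Qed.

Definition gmap_id (X : gset G) : gmap X X :=
  @mk_gmap X X id (fun _ _ => erefl).

Fact gmap_comp_subproof (X Y Z : gset G) (k : gmap Y Z) (f : gmap X Y) g x :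
  k (f (g ** x)) = g ** k (f x).
Proof. by rewrite !gmapE. Qed.

Definition gmap_comp (X Y Z : gset G) (k : gmap Y Z) (f : gmap X Y) :
  gmap X Z := mk_gmap (gmap_comp_subproof k f).

Lemma gact_inv (X : gset G) (g : G) (x : X) : g^-1 ** g ** x = x.
Proof. by rewrite -gactM mulVg gact1. Qed.

Lemma gact_invr (X : gset G) (g : G) (x : X) : g ** g^-1 ** x = x.
Proof. by rewrite -gactM mulgV gact1. Qed.

End GMaps.

Arguments mk_gmap : simpl never.

Record slice_obj (G : finGroupType) (X : gset G) := SliceObj {
  sdom :> gset G;
  sproj : gmap sdom X }.

Arguments sproj {G X} A : rename.

Record slice_hom (G : finGroupType) (X : gset G) (A B : slice_obj X) :=
  SliceHom {
    sfun :> gmap A B;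
    _ : [forall a : A, sproj B (sfun a) == sproj A a] }.

HB.instance Definition _ (G : finGroupType) (X : gset G)
  (A B : slice_obj X) := [isSub for @sfun G X A B].

Section Slice.
Variables (G : finGroupType) (X : gset G).
Implicit Types A B C : slice_obj X.

Lemma slice_homE A B (f : slice_hom A B) a : sproj B (f a) = sproj A a.
Proof. by case: f => f /= /forallP/(_ a)/eqP. Qed.

Lemma slice_hom_eq A B (f f' : slice_hom A B) : f =1 f' -> f = f'.
Proof. by move=> ff'; apply/val_inj/gmap_eq. Qed.

Fact mk_slice_hom_subproof A B (f : A -> B)
    (fP : forall g a, f (g ** a) = g ** f a) :
  (forall a, sproj B (f a) = sproj A a) ->
  [forall a : A, sproj B (mk_gmap fP a) == sproj A a].
Proof. by move=> pf; apply/forallP=> a; rewrite mk_gmapE pf. Qed.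

Definition mk_slice_hom A B (f : A -> B)
    (fP : forall g a, f (g ** a) = g ** f a)
    (pf : forall a, sproj B (f a) = sproj A a) : slice_hom A B :=
  SliceHom (mk_slice_hom_subproof fP pf).

Lemma mk_slice_homE A B (f : A -> B) fP pf a :
  @mk_slice_hom A B f fP pf a = f a.
Proof. exact: mk_gmapE. Qed.

Definition slice_id A : slice_hom A A :=
  @mk_slice_hom A A id (fun _ _ => erefl) (fun _ => erefl).

Fact slice_comp_subproof A B C (k : slice_hom B C) (f : slice_hom A B) a :
  sproj C (k (f a)) = sproj A a.
Proof. by rewrite !slice_homE. Qed.

Definition slice_comp A B C (k : slice_hom B C) (f : slice_hom A B) :
    slice_hom A C :=
  mk_slice_hom (gmap_comp_subproof k f) (slice_comp_subproof k f).

Fact slice_comp1m A B (f : slice_hom A B) : slice_comp (slice_id B) f = f.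
Proof. by apply: slice_hom_eq => a; rewrite !mk_slice_homE. Qed.

Fact slice_compm1 A B (f : slice_hom A B) : slice_comp f (slice_id A) = f.
Proof. by apply: slice_hom_eq => a; rewrite !mk_slice_homE. Qed.

Fact slice_compA A B C D (h : slice_hom C D) (k : slice_hom B C)
    (f : slice_hom A B) :
  slice_comp h (slice_comp k f) = slice_comp (slice_comp h k) f.
Proof. by apply: slice_hom_eq => a; rewrite !mk_slice_homE. Qed.

Definition slice : category :=
  @Category (slice_obj X) (@slice_hom G X) slice_id slice_comp
    slice_comp1m slice_compm1 slice_compA.

Lemma slice_idE A a : slice_id A a = a.
Proof. exact: mk_slice_homE. Qed.

Lemma slice_compE A B C (k : slice_hom B C) (f : slice_hom A B) a :
  slice_comp k f a = k (f a).
Proof. exact: mk_slice_homE. Qed.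

Definition slice_simp := (slice_idE, slice_compE, mk_slice_homE).

Definition slice_top : slice_obj X := SliceObj (gmap_id X).

Lemma slice_topE x : sproj slice_top x = x.
Proof. exact: mk_gmapE. Qed.

End Slice.

Arguments mk_slice_hom : simpl never.
Arguments slice_id : simpl never.
Arguments slice_comp : simpl never.

Section SlicePush.
Variables (H : finGroupType) (W Y : gset H) (f : gmap W Y).

Definition push_obj (B : slice_obj W) : slice_obj Y :=
  SliceObj (gmap_comp f (sproj B)).

Fact push_hom_subproof (B C : slice_obj W) (k : slice_hom B C) b :
  sproj (push_obj C) (k b) = sproj (push_obj B) b.
Proof. by rewrite !mk_gmapE slice_homE. Qed.

Definition push_hom (B C : slice_obj W) (k : slice_hom B C) :
    slice_hom (push_obj B) (push_obj C) :=
  @mk_slice_hom H Y (push_obj B) (push_obj C) k (gmapE k)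
    (push_hom_subproof k).

Fact push1 (B : slice_obj W) : push_hom (slice_id B) = slice_id (push_obj B).
Proof. by apply: slice_hom_eq => b; rewrite !slice_simp. Qed.

Fact pushM (B C D : slice_obj W) (k' : slice_hom C D) (k : slice_hom B C) :
  push_hom (slice_comp k' k) = slice_comp (push_hom k') (push_hom k).
Proof. by apply: slice_hom_eq => b; rewrite !slice_simp. Qed.

Definition slice_push : functor (slice W) (slice Y) :=
  @Functor (slice W) (slice Y) push_obj push_hom push1 pushM.

End SlicePush.

Section DependentProduct.
Variables (H : finGroupType) (W Y : gset H) (f : gmap W Y).

Definition fiber (y : Y) : finType := {w : W | f w == y}.

Fact fiber_act_subproof (h : H) (y : Y) (w : fiber (h ** y)) :
  f (h^-1 ** val w) == y.
Proof. by rewrite gmapE (eqP (valP w)) gact_inv. Qed.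

Definition fiber_act (h : H) (y : Y) (w : fiber (h ** y)) : fiber y :=
  exist _ (h^-1 ** val w) (fiber_act_subproof w).

Section Objects.
Variable B : slice_obj W.

Definition partial_section (y : Y) : finType :=
  {s : {ffun fiber y -> B} | [forall w, sproj B (s w) == val w]}.

Definition Pi_set : finType := {y : Y & partial_section y}.

Lemma partial_sectionE (y : Y) (s : partial_section y) w :
  sproj B (val s w) = val w.
Proof. by apply/eqP; move: w; apply/forallP; apply: (valP s). Qed.

Lemma Pi_eq (p q : Pi_set) :
  tag p = tag q ->
  (forall w u, val w = val u ->
     val (tagged p) w = val (tagged q) u) -> p = q.
Proof.
case: p q => [y s] [y' s'] /= eq_y; case: y' / eq_y s' => s' eq_s.
by congr existT; apply/val_inj/ffunP => w; apply: eq_s.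
Qed.

Fact Pi_act_subproof (h : H) (y : Y) (s : partial_section y) :
  [forall w, sproj B ([ffun w : fiber (h ** y) => h ** val s (fiber_act w)] w)
             == val w].
Proof.
by apply/forallP=> w; rewrite ffunE gmapE partial_sectionE /= gact_invr.
Qed.

Definition Pi_act (h : H) (p : Pi_set) : Pi_set :=
  existT partial_section (h ** tag p)
    (exist _ [ffun w : fiber (h ** tag p) => h ** val (tagged p) (fiber_act w)]
       (Pi_act_subproof h (tagged p))).

Fact Pi_act1 p : Pi_act 1 p = p.
Proof.
apply: Pi_eq => [|w u wu]; first exact: gact1.
rewrite /= ffunE gact1; congr (val (tagged p) _); apply/val_inj.
by rewrite /= invg1 (@gact1 _ W).
Qed.

Fact Pi_actM h h' p : Pi_act (h * h') p = Pi_act h (Pi_act h' p).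
Proof.
apply: Pi_eq => [|w u wu]; first exact: gactM.
rewrite /= !ffunE gactM; congr (_ ** _ ** val (tagged p) _); apply/val_inj.
by rewrite /= invMg (@gactM _ W) wu.
Qed.

Definition Pi_gset : gset H := GSet Pi_act1 Pi_actM.

Definition Pi_obj : slice_obj Y :=
  SliceObj (@mk_gmap H Pi_gset Y (fun p => tag p) (fun _ _ => erefl)).

End Objects.

Section Morphisms.
Variables (B C : slice_obj W) (k : slice_hom B C).

Fact Pi_fun_subproof (y : Y) (s : partial_section B y) :
  [forall w, sproj C ([ffun w => k (val s w)] w) == val w].
Proof. by apply/forallP=> w; rewrite ffunE slice_homE partial_sectionE. Qed.

Definition Pi_fun (p : Pi_obj B) : Pi_obj C :=
  existT (partial_section C) (tag p)
    (exist _ [ffun w => k (val (tagged p) w)] (Pi_fun_subproof (tagged p))).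

Fact Pi_fun_equi h p : Pi_fun (h ** p) = h ** Pi_fun p.
Proof.
apply: Pi_eq => //= w u wu; rewrite !ffunE gmapE.
by have -> : w = u by exact: val_inj.
Qed.

Fact Pi_fun_proj p : sproj (Pi_obj C) (Pi_fun p) = sproj (Pi_obj B) p.
Proof. by rewrite !mk_gmapE. Qed.

Definition Pi_hom : slice_hom (Pi_obj B) (Pi_obj C) :=
  mk_slice_hom Pi_fun_equi Pi_fun_proj.

End Morphisms.

Fact Pi1 (B : slice_obj W) : Pi_hom (slice_id B) = slice_id (Pi_obj B).
Proof.
apply: slice_hom_eq => p; rewrite !slice_simp.
apply: Pi_eq => //= w u wu; rewrite ffunE !slice_simp.
by have -> : w = u by exact: val_inj.
Qed.

Fact PiM (B C D : slice_obj W) (k' : slice_hom C D) (k : slice_hom B C) :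
  Pi_hom (slice_comp k' k) = slice_comp (Pi_hom k') (Pi_hom k).
Proof.
apply: slice_hom_eq => p; rewrite !slice_simp.
apply: Pi_eq => //= w u wu; rewrite !ffunE.
by have -> : w = u by exact: val_inj.
Qed.

Definition slice_Pi : functor (slice W) (slice Y) :=
  @Functor (slice W) (slice Y) Pi_obj Pi_hom Pi1 PiM.

End DependentProduct.

(* A 0-cell X/G is presented by the two arguments G and X. *)
Record cell1 (G H : finGroupType) (X : gset G) (Y : gset H) := Cell1 {
  cmap : X -> Y;
  ctheta : X -> G -> H;
  cmapE : forall (g : G) (x : X), cmap (g ** x) = ctheta x g ** cmap x;
  cthetaM : forall (x : X) (g g' : G),
    ctheta x (g * g') = ctheta (g' ** x) g * ctheta x g' }.

Section Cell.
Variables (G H : finGroupType) (X : gset G) (Y : gset H) (c : cell1 X Y).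

Local Notation alpha := (cmap c).
Local Notation theta := (ctheta c).

Lemma ctheta1 x : theta x 1 = 1.
Proof.
by apply: (mulgI (theta x 1)); rewrite -{1}(gact1 x) -cthetaM !mulg1.
Qed.



Lemma cthetaV x g : theta (g ** x) g^-1 = (theta x g)^-1.
Proof. by apply: (mulIg (theta x g)); rewrite -cthetaM !mulVg ctheta1. Qed.

Section Pullback.

Section Objects.
Variable B : slice_obj Y.

Definition pull_set : finType := {p : X * B | alpha p.1 == sproj B p.2}.

Fact pull_act_subproof (g : G) (p : pull_set) :
  alpha (g ** (val p).1) == sproj B (theta (val p).1 g ** (val p).2).
Proof. by rewrite cmapE gmapE (eqP (valP p)). Qed.

Definition pull_act (g : G) (p : pull_set) : pull_set :=
  exist _ (g ** (val p).1, theta (val p).1 g ** (val p).2)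
    (pull_act_subproof g p).

Fact pull_act1 p : pull_act 1 p = p.
Proof.
by apply: val_inj; case: p => -[x b] p /=; rewrite ctheta1 !gact1.
Qed.

Fact pull_actM g g' p : pull_act (g * g') p = pull_act g (pull_act g' p).
Proof. by apply: val_inj; rewrite /= cthetaM !gactM. Qed.

Definition pull_gset : gset G := GSet pull_act1 pull_actM.

Definition pull_obj : slice_obj X :=
  SliceObj (@mk_gmap G pull_gset X (fun p => (val p).1) (fun _ _ => erefl)).

End Objects.

Section Morphisms.
Variables (B C : slice_obj Y) (f : slice_hom B C).

Fact pull_fun_subproof (p : pull_obj B) :
  alpha (val p).1 == sproj C (f (val p).2).
Proof. by rewrite slice_homE (eqP (valP p)). Qed.

Definition pull_fun (p : pull_obj B) : pull_obj C :=
  exist _ ((val p).1, f (val p).2) (pull_fun_subproof p).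

Fact pull_fun_equi g p : pull_fun (g ** p) = g ** pull_fun p.
Proof. by apply: val_inj; rewrite /= gmapE. Qed.

Fact pull_fun_proj p : sproj (pull_obj C) (pull_fun p) = sproj (pull_obj B) p.
Proof. by rewrite !mk_gmapE. Qed.

Definition pull_hom : slice_hom (pull_obj B) (pull_obj C) :=
  mk_slice_hom pull_fun_equi pull_fun_proj.

End Morphisms.

Fact pull1 (B : slice_obj Y) : pull_hom (slice_id B) = slice_id (pull_obj B).
Proof.
apply: slice_hom_eq => p; rewrite !slice_simp; apply: val_inj.
by case: p => -[x b] p /=; rewrite !slice_simp.
Qed.

Fact pullM (B C D : slice_obj Y) (f' : slice_hom C D) (f : slice_hom B C) :
  pull_hom (slice_comp f' f) = slice_comp (pull_hom f') (pull_hom f).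
Proof.
apply: slice_hom_eq => p; rewrite !slice_simp; apply: val_inj.
by rewrite /= !slice_simp.
Qed.

Definition cell_star : functor (slice Y) (slice X) :=
  @Functor (slice Y) (slice X) pull_obj pull_hom pull1 pullM.

End Pullback.

Section Induction.

Section Objects.
Variable A : slice_obj X.

Definition ind_rel (p q : H * A) : bool :=
  [exists g : G, (q.2 == g ** p.2) && (p.1 == q.1 * theta (sproj A p.2) g)].

Fact ind_rel_refl : reflexive ind_rel.
Proof.
by move=> p; apply/existsP; exists 1; rewrite gact1 ctheta1 mulg1 !eqxx.
Qed.

Fact ind_rel_symW p q : ind_rel p q -> ind_rel q p.
Proof.
case: p q => [e a] [e' a'] /existsP[g /= /andP[/eqP-> /eqP->]].
apply/existsP; exists g^-1; rewrite /= gact_inv gmapE eqxx /=.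
by rewrite cthetaV mulgK.
Qed.

Fact ind_rel_sym : symmetric ind_rel.
Proof. by move=> p q; apply/idP/idP; apply: ind_rel_symW. Qed.

Fact ind_rel_trans : transitive ind_rel.
Proof.
move=> [e' a'] [e a] [e'' a''] /existsP[g /= /andP[/eqP-> /eqP->]].
move=> /existsP[g' /= /andP[/eqP-> /eqP->]].
by apply/existsP; exists (g' * g); rewrite /= gactM gmapE cthetaM mulgA !eqxx.
Qed.

Canonical ind_equiv := EquivRel ind_rel ind_rel_refl ind_rel_sym ind_rel_trans.

Definition ind_set := {eq_quot ind_rel}.
HB.instance Definition _ := EqQuotient.on ind_set.
HB.instance Definition _ := Choice.on ind_set.
HB.instance Definition _ : isCountable ind_set := CanIsCountable (@reprK _ ind_set).
HB.instance Definition _ : isFinite ind_set := CanIsFinite (@reprK _ ind_set).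

Definition ind_class (eta : H) (a : A) : ind_set := \pi_ind_set (eta, a).

Lemma ind_classP e a e' a' :
  reflect (exists g, a' = g ** a /\ e = e' * theta (sproj A a) g)
          (ind_class e a == ind_class e' a').
Proof.
rewrite /ind_class eqmodE; apply: (iffP existsP) => -[g] /=.
  by case/andP=> /eqP ? /eqP ?; exists g.
by case=> -> ->; exists g; rewrite !eqxx.
Qed.

Lemma ind_repr (z : ind_set) : z = ind_class (repr z).1 (repr z).2.
Proof. by rewrite /ind_class -surjective_pairing reprK. Qed.

Lemma ind_reprP e a : exists g,
  a = g ** (repr (ind_class e a)).2
  /\ (repr (ind_class e a)).1
     = e * theta (sproj A (repr (ind_class e a)).2) g.
Proof. by apply/ind_classP; rewrite -ind_repr. Qed.

(* Operations on classes are defined on representatives; the lemmas ind_actE,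
   ind_funE, ind_proj_funE and tilde_alpha_funE give their value on [eta, a]. *)
Definition ind_act (h : H) (z : ind_set) : ind_set :=
  ind_class (h * (repr z).1) (repr z).2.

Lemma ind_actE h e a : ind_act h (ind_class e a) = ind_class (h * e) a.
Proof.
rewrite /ind_act; have := ind_reprP e a; move: (repr _) => [e' a'] /= [g [-> ->]].
by apply/eqP/ind_classP; exists g; rewrite mulgA.
Qed.

Fact ind_act1 z : ind_act 1 z = z.
Proof. by rewrite (ind_repr z) ind_actE mul1g. Qed.

Fact ind_actM h h' z : ind_act (h * h') z = ind_act h (ind_act h' z).
Proof. by rewrite (ind_repr z) !ind_actE mulgA. Qed.

Definition ind_gset : gset H := GSet ind_act1 ind_actM.

End Objects.

Section Morphisms.
Variables (A B : slice_obj X) (f : slice_hom A B).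

Definition ind_fun (z : ind_gset A) : ind_gset B :=
  ind_class (repr z).1 (f (repr z).2).

Lemma ind_funE e a : ind_fun (ind_class e a) = ind_class e (f a).
Proof.
rewrite /ind_fun; have := ind_reprP e a; move: (repr _) => [e' a'] /= [g [-> ->]].
by apply/eqP/ind_classP; exists g; rewrite gmapE slice_homE.
Qed.

Fact ind_fun_equi h z : ind_fun (h ** z) = h ** ind_fun z.
Proof. by rewrite (ind_repr z) /= ind_actE !ind_funE /= ind_actE. Qed.

End Morphisms.

Definition SIm : gset H := ind_gset (slice_top X).

Definition tilde_alpha_fun (z : SIm) : Y := (repr z).1 ** alpha (repr z).2.

Lemma tilde_alpha_funE e (x : X) :
  tilde_alpha_fun (@ind_class (slice_top X) e x) = e ** alpha x.
Proof.
rewrite /tilde_alpha_fun; have := @ind_reprP (slice_top X) e x.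
move: (repr _) => [e' x'] [g [-> ->]].
by rewrite slice_topE gactM -cmapE.
Qed.

Fact tilde_alpha_equi h z : tilde_alpha_fun (h ** z) = h ** tilde_alpha_fun z.
Proof. by rewrite (ind_repr z) /= ind_actE !tilde_alpha_funE gactM. Qed.

Definition tilde_alpha : gmap SIm Y := mk_gmap tilde_alpha_equi.

Definition ind_proj_fun (A : slice_obj X) (z : ind_gset A) : SIm :=
  @ind_class (slice_top X) (repr z).1 (sproj A (repr z).2).

Lemma ind_proj_funE (A : slice_obj X) e (a : A) :
  ind_proj_fun (ind_class e a) = @ind_class (slice_top X) e (sproj A a).
Proof.
rewrite /ind_proj_fun; have := ind_reprP e a; move: (repr _) => [e' a'] /= [g [-> ->]].
by apply/eqP/ind_classP; exists g; rewrite gmapE slice_topE.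
Qed.

Fact ind_proj_equi (A : slice_obj X) h (z : ind_gset A) :
  ind_proj_fun (h ** z) = h ** ind_proj_fun z.
Proof. by rewrite (ind_repr z) /= ind_actE !ind_proj_funE /= ind_actE. Qed.

Definition ind_obj (A : slice_obj X) : slice_obj SIm :=
  SliceObj (mk_gmap (@ind_proj_equi A)).

Fact ind_fun_proj (A B : slice_obj X) (f : slice_hom A B) z :
  sproj (ind_obj B) (ind_fun f z) = sproj (ind_obj A) z.
Proof.
by rewrite !mk_gmapE (ind_repr z) ind_funE !ind_proj_funE slice_homE.
Qed.

Definition ind_hom (A B : slice_obj X) (f : slice_hom A B) :
    slice_hom (ind_obj A) (ind_obj B) :=
  @mk_slice_hom _ _ (ind_obj A) (ind_obj B) (ind_fun f) (ind_fun_equi f)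
    (ind_fun_proj f).

Fact ind1 (A : slice_obj X) : ind_hom (slice_id A) = slice_id (ind_obj A).
Proof.
apply: slice_hom_eq => z; rewrite !slice_simp.
by rewrite (ind_repr z) ind_funE !slice_simp.
Qed.

Fact indM (A B C : slice_obj X) (f' : slice_hom B C) (f : slice_hom A B) :
  ind_hom (slice_comp f' f) = slice_comp (ind_hom f') (ind_hom f).
Proof.
apply: slice_hom_eq => z; rewrite !slice_simp.
by rewrite (ind_repr z) !ind_funE !slice_simp.
Qed.

Definition cell_S : functor (slice X) (slice SIm) :=
  @Functor (slice X) (slice SIm) ind_obj ind_hom ind1 indM.

End Induction.

Section ThetaPart.

Section Objects.
Variable A : slice_obj X.

Definition in_theta_part (a : A) : bool :=
  [forall g : G, forall g' : G,
     (theta (sproj A a) g == theta (sproj A a) g')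
     && (g ** sproj A a == g' ** sproj A a) ==> (g ** a == g' ** a)].

Lemma in_theta_partP (a : A) :
  reflect (forall g g' : G,
             theta (sproj A a) g = theta (sproj A a) g' ->
             g ** sproj A a = g' ** sproj A a -> g ** a = g' ** a)
          (in_theta_part a).
Proof.
apply: (iffP forallP) => [Pa g g' e1 e2 | Pa g].
  move/forallP: (Pa g) => /(_ g') /implyP Pgg'; apply/eqP/Pgg'.
  by rewrite e1 e2 !eqxx.
by apply/forallP=> g'; apply/implyP=> /andP[/eqP e1 /eqP e2]; apply/eqP/Pa.
Qed.

Definition theta_part_set : finType := {a : A | in_theta_part a}.

Fact theta_part_act_subproof (g : G) (a : theta_part_set) :
  in_theta_part (g ** val a).
Proof.
apply/in_theta_partP=> h h'; rewrite !gmapE => e1 e2.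
have /in_theta_partP Pa := valP a.
by rewrite -!gactM; apply: Pa; rewrite ?cthetaM ?gactM ?e1.
Qed.

Definition theta_part_act (g : G) (a : theta_part_set) : theta_part_set :=
  exist _ (g ** val a) (theta_part_act_subproof g a).

Fact theta_part_act1 a : theta_part_act 1 a = a.
Proof. by apply: val_inj; rewrite /= gact1. Qed.

Fact theta_part_actM g g' a :
  theta_part_act (g * g') a = theta_part_act g (theta_part_act g' a).
Proof. by apply: val_inj; rewrite /= gactM. Qed.

Definition theta_part_gset : gset G := GSet theta_part_act1 theta_part_actM.

Fact theta_part_proj_equi g (a : theta_part_gset) :
  sproj A (val (g ** a)) = g ** sproj A (val a).
Proof. exact: gmapE. Qed.

Definition theta_part_obj : slice_obj X :=
  SliceObj (mk_gmap theta_part_proj_equi).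

End Objects.

Section Morphisms.
Variables (A B : slice_obj X) (f : slice_hom A B).

Fact theta_part_fun_subproof (a : theta_part_obj A) : in_theta_part (f (val a)).
Proof.
have /in_theta_partP Pa := valP a.
apply/in_theta_partP=> g g'; rewrite slice_homE => e1 e2.
by rewrite -!gmapE (Pa _ _ e1 e2).
Qed.

Definition theta_part_fun (a : theta_part_obj A) : theta_part_obj B :=
  exist _ (f (val a)) (theta_part_fun_subproof a).

Fact theta_part_fun_equi g a :
  theta_part_fun (g ** a) = g ** theta_part_fun a.
Proof. by apply: val_inj; rewrite /= gmapE. Qed.

Fact theta_part_fun_proj a :
  sproj (theta_part_obj B) (theta_part_fun a) = sproj (theta_part_obj A) a.
Proof. by rewrite !mk_gmapE slice_homE. Qed.

Definition theta_part_hom :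
    slice_hom (theta_part_obj A) (theta_part_obj B) :=
  mk_slice_hom theta_part_fun_equi theta_part_fun_proj.

End Morphisms.

Fact theta_part1 (A : slice_obj X) :
  theta_part_hom (slice_id A) = slice_id (theta_part_obj A).
Proof.
apply: slice_hom_eq => a; apply: val_inj.
by rewrite !slice_simp /= !slice_simp.
Qed.

Fact theta_partM (A B C : slice_obj X) (f' : slice_hom B C)
    (f : slice_hom A B) :
  theta_part_hom (slice_comp f' f)
  = slice_comp (theta_part_hom f') (theta_part_hom f).
Proof.
apply: slice_hom_eq => a; apply: val_inj.
by rewrite !slice_simp /= !slice_simp.
Qed.

Definition cell_theta_part : functor (slice X) (slice X) :=
  @Functor (slice X) (slice X) theta_part_obj theta_part_hom
    theta_part1 theta_partM.

End ThetaPart.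

(* For c = alpha/theta: ind_set A is H x_G A, ind_class eta a is [eta, a],
   cell_S is S_theta, cell_theta_part is (-)^theta, and cell_plus, cell_star,
   cell_bullet are the functors usually decorated with _+, ^*, _bullet. *)
Definition cell_plus : functor (slice X) (slice Y) :=
  functor_comp (slice_push tilde_alpha) cell_S.

Definition cell_bullet : functor (slice X) (slice Y) :=
  functor_comp (slice_Pi tilde_alpha) (functor_comp cell_S cell_theta_part).

End Cell.

(* Main.v *)
Require Import Defs.
From mathcomp Require Import all_boot fingroup.
From mathcomp Require Import generic_quotient.

Set Implicit Arguments.
Unset Strict Implicit.
Unset Printing Implicit Defensive.

Local Open Scope group_scope.

(** Both adjunctions come from explicit transpositions. Write p for the
structure map of an object over X.

For the left adjoint, induction along theta is governed by the relation
[eta, g a] = [eta theta_(p a)(g), a]. An H-map u out of the induced set is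
therefore determined by the elements u [1, a], and a |-> (p a, u [1, a]) is a
G-map into the pullback: the twisted action g (x, b) = (g x, theta_x(g) b)
matches that relation. Conversely (x, b) = v a is turned back into the H-map
[eta, a] |-> eta b.

For the right adjoint, two facts explain the three factors of the functor.
- An element (x, b) of a pullback satisfies g (x, b) = g' (x, b) as soon as
  theta_x(g) = theta_x(g') and g x = g' x. So a map u from a pullback to A
  takes its values in A^theta, and factors through it ([theta_lift]).
- On A^theta the relation identifying classes does not collapse fibers: the
  elements of the induced set over [eta, x] are exactly the [eta, a] with a
  over x, and a is determined by its class ([ind_proj_lift],
  [theta_part_ind_inj]).
Given u from the pullback of B to A, and b in B over y, the partial section
attached to b sends a point [eta, x] of the fiber of y to
[eta, u (x, eta^-1 b)], where (x, eta^-1 b) lies in the pullback because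
eta alpha(x) = y. Conversely, from v, the value at (x, b) is the unique a in
A^theta over x such that the partial section v b takes the value [1, a] at
[1, x]. Equivariance of v says that the value of v b at [eta, x] is eta times
the value of v (eta^-1 b) at [1, x]; hence v is recovered from its values at
the classes [1, x] ([bullet_hom_value]), and the two transpositions are
mutually inverse. *)

Section Cell.
Variables (G H : finGroupType) (X : gset G) (Y : gset H) (c : cell1 X Y).

Local Notation alpha := (cmap c).
Local Notation theta := (ctheta c).
Local Notation sim e x := (@ind_class G H X Y c (slice_top X) e x).

Lemma ind_class_act (A : slice_obj X) (e : H) (a : A) (g : G) :
  ind_class c e (g ** a) = ind_class c (e * theta (sproj A a) g) a.
Proof. by apply/esym/eqP/ind_classP; exists g. Qed.

(** Lets an element of the induced set be replaced by a class [eta, a], on which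
the operations have a computation rule, without naming its representative. *)
Lemma ind_class_ind (A : slice_obj X) (P : ind_set c A -> Prop) :
  (forall e a, P (ind_class c e a)) -> forall z, P z.
Proof. by move=> PA z; rewrite (ind_repr z). Qed.

Lemma pull_eqP (B : slice_obj Y) (p : pull_obj c B) :
  alpha (val p).1 = sproj B (val p).2.
Proof. exact: eqP (valP p). Qed.

(** * The left adjoint *)

Section LeftAdjoint.

Section Transpose.
Variables (A : slice_obj X) (B : slice_obj Y).

Lemma cell_plus_projE e (a : A) :
  sproj (cell_plus c A) (ind_class c e a) = e ** alpha (sproj A a).
Proof. by rewrite !mk_gmapE ind_proj_funE tilde_alpha_funE. Qed.

Section Forward.
Variable u : slice_hom (cell_plus c A) B.

(** Since [eta, a] = eta [1, a], the values u [1, a] determine u. *)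
Lemma plus_hom_class e (a : A) :
  u (ind_class c e a) = e ** u (ind_class c 1 a).
Proof. by rewrite -(gmapE u); congr (u _); rewrite [RHS]ind_actE mulg1. Qed.

Fact plus_transpose_subproof (a : A) :
  alpha (sproj A a, u (ind_class c 1 a)).1
  == sproj B (sproj A a, u (ind_class c 1 a)).2.
Proof. by rewrite (slice_homE u) cell_plus_projE gact1. Qed.

Definition plus_transpose_fun (a : A) : pull_obj c B :=
  exist _ (sproj A a, u (ind_class c 1 a)) (plus_transpose_subproof a).

Fact plus_transpose_equi g a :
  plus_transpose_fun (g ** a) = g ** plus_transpose_fun a.
Proof.
by apply: val_inj; rewrite /= gmapE ind_class_act mul1g plus_hom_class.
Qed.

Fact plus_transpose_proj a :
  sproj (pull_obj c B) (plus_transpose_fun a) = sproj A a.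
Proof. by rewrite mk_gmapE. Qed.

Definition plus_transpose : slice_hom A (pull_obj c B) :=
  mk_slice_hom plus_transpose_equi plus_transpose_proj.

End Forward.

Section Backward.
Variable v : slice_hom A (pull_obj c B).

Lemma pull_hom_val1 a : (val (v a)).1 = sproj A a.
Proof. by rewrite -(slice_homE v) mk_gmapE. Qed.

(** Independence of the representative is [plus_untranspose_funE]. *)
Definition plus_untranspose_fun (z : cell_plus c A) : B :=
  (repr z).1 ** (val (v (repr z).2)).2.

Lemma plus_untranspose_funE e a :
  plus_untranspose_fun (ind_class c e a) = e ** (val (v a)).2.
Proof.
rewrite /plus_untranspose_fun; have := ind_reprP c e a.
move: (repr _) => [e' a'] /= [g [-> ->]].
by rewrite (gmapE v) /= pull_hom_val1 gactM.
Qed.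

Fact plus_untranspose_equi h z :
  plus_untranspose_fun (h ** z) = h ** plus_untranspose_fun z.
Proof.
elim/ind_class_ind: z => e a.
by rewrite [h ** _]ind_actE !plus_untranspose_funE gactM.
Qed.

Fact plus_untranspose_proj z :
  sproj B (plus_untranspose_fun z) = sproj (cell_plus c A) z.
Proof.
elim/ind_class_ind: z => e a.
by rewrite plus_untranspose_funE cell_plus_projE gmapE -pull_eqP pull_hom_val1.
Qed.

Definition plus_untranspose : slice_hom (cell_plus c A) B :=
  mk_slice_hom plus_untranspose_equi plus_untranspose_proj.

Lemma plus_untransposeE e a :
  plus_untranspose (ind_class c e a) = e ** (val (v a)).2.
Proof. by rewrite -plus_untranspose_funE; apply: mk_slice_homE. Qed.

End Backward.

Lemma plus_transposeK : cancel plus_transpose plus_untranspose.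
Proof.
move=> u; apply: slice_hom_eq; elim/ind_class_ind => e a.
by rewrite plus_untransposeE slice_simp /= -plus_hom_class.
Qed.

Lemma plus_untransposeK : cancel plus_untranspose plus_transpose.
Proof.
move=> v; apply: slice_hom_eq => a; rewrite slice_simp; apply: val_inj.
rewrite /= plus_untransposeE gact1 -(pull_hom_val1 v).
by rewrite -surjective_pairing.
Qed.

End Transpose.

Lemma plus_transpose_nat (A A' : slice_obj X) (B B' : slice_obj Y)
    (h : slice_hom A' A) (u : slice_hom (cell_plus c A) B)
    (k : slice_hom B B') :
  plus_transpose
    (slice_comp k (slice_comp u (push_hom (tilde_alpha c) (ind_hom c h))))
  = slice_comp (pull_hom c k) (slice_comp (plus_transpose u) h).
Proof.
apply: slice_hom_eq => a; rewrite !slice_simp; apply: val_inj.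
by rewrite /= slice_homE !ffunE ind_funE.
Qed.

Lemma cell_plus_star_adjunction : left_adjoint_to (cell_plus c) (cell_star c).
Proof.
constructor.
apply: (@Adjunction _ _ (cell_plus c) (cell_star c) plus_transpose).
  by move=> A B; exists (@plus_untranspose A B);
     [apply: plus_transposeK | apply: plus_untransposeK].
exact: plus_transpose_nat.
Qed.

End LeftAdjoint.

(** * The right adjoint *)

Section RightAdjoint.

(** If [eta', a] lies over [eta, x], then some g relates the representatives
(eta', p a) and (eta, x), and translating a by this g moves it over x without
changing its class. *)
Lemma ind_proj_lift (A : slice_obj X) (z : ind_set c A) e x :
  sproj (ind_obj c A) z = sim e x ->
  exists2 a : A, sproj A a = x & z = ind_class c e a.
Proof.
elim/ind_class_ind: z => e' a; rewrite mk_gmapE ind_proj_funE => /eqP.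
case/ind_classP => g [-> ->]; exists (g ** a); first exact: gmapE.
by rewrite ind_class_act slice_topE.
Qed.

(** An equality [eta, a] = [eta, a'] provides g with a' = g a and theta(g) = 1;
when a and a' lie over the same x, moreover g x = x. The condition defining
the theta-part, applied to g and 1, then gives g a = a. *)
Lemma theta_part_ind_inj (A : slice_obj X) e (a a' : theta_part_obj c A) :
  sproj _ a = sproj _ a' -> ind_class c e a = ind_class c e a' -> a = a'.
Proof.
move=> eq_x /eqP/ind_classP[g [def_a' /(canLR (mulKg e))]].
rewrite mulVg => /esym th_g; rewrite def_a' in eq_x *.
rewrite gmapE in eq_x; have /in_theta_partP Pa := valP a.
apply: val_inj; rewrite /= -[LHS]gact1; apply: Pa.
  by rewrite ctheta1 -th_g mk_gmapE.
by move: eq_x; rewrite gact1 mk_gmapE.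
Qed.

(** Points of the fibers over tag q and over k (tag p) have different types even
when q = k p. Comparing the points through their images in W avoids every
transport between these fibers. *)
Lemma Pi_act_val (K : finGroupType) (W Z : gset K) (f : gmap W Z)
    (B : slice_obj W) (p q : Pi_gset f B) k w u :
  q = k ** p -> val u = k ** val w ->
  val (tagged q) u = k ** val (tagged p) w.
Proof.
move=> def_q; move: u; rewrite def_q => u def_u; rewrite /= ffunE.
congr (_ ** val (tagged p) _); apply: val_inj.
by rewrite /= def_u (@gact_inv _ W).
Qed.

Section Transpose.
Variables (B : slice_obj Y) (A : slice_obj X).

Section Forward.
Variable u : slice_hom (pull_obj c B) A.

(** In the pullback, g (x, b) depends on g only through g x and theta_x(g), and
the map u is equivariant. *)
Fact theta_lift_subproof (p : pull_obj c B) : in_theta_part c (u p).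
Proof.
apply/in_theta_partP => g g'; rewrite slice_homE !mk_gmapE => e1 e2.
by rewrite -!gmapE; congr (u _); apply: val_inj; rewrite /= e1 e2.
Qed.

Definition theta_lift_fun (p : pull_obj c B) : theta_part_obj c A :=
  exist _ (u p) (theta_lift_subproof p).

Fact theta_lift_equi g p : theta_lift_fun (g ** p) = g ** theta_lift_fun p.
Proof. by apply: val_inj; rewrite /= (gmapE u). Qed.

Fact theta_lift_proj p :
  sproj (theta_part_obj c A) (theta_lift_fun p) = sproj (pull_obj c B) p.
Proof. by rewrite mk_gmapE slice_homE. Qed.

Definition theta_lift : slice_hom (pull_obj c B) (theta_part_obj c A) :=
  mk_slice_hom theta_lift_equi theta_lift_proj.

Lemma theta_lift_val p : val (theta_lift p) = u p.
Proof. by rewrite slice_simp. Qed.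

(** If w = [e, x] lies over the image of b, then e alpha(x) is that image, so
alpha(x) is the image of e^-1 b. *)
Fact fiber_pull_subproof (b : B) (w : fiber (tilde_alpha c) (sproj B b)) :
  alpha (repr (val w)).2 == sproj B ((repr (val w)).1^-1 ** b).
Proof.
move: (eqP (valP w)); rewrite gmapE; move: (val w) => {w} z <-.
by rewrite {3}(ind_repr z) mk_gmapE tilde_alpha_funE gact_inv.
Qed.

Definition fiber_pull (b : B) (w : fiber (tilde_alpha c) (sproj B b)) :
    pull_obj c B :=
  exist _ ((repr (val w)).2, (repr (val w)).1^-1 ** b) (fiber_pull_subproof w).

(** The point (x, eta^-1 b) is chosen with the canonical representative
(eta, x) of w; [bullet_sectionE] allows any other one. *)
Definition bullet_section (b : B) (w : fiber (tilde_alpha c) (sproj B b)) :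
    ind_obj c (theta_part_obj c A) :=
  ind_class c (repr (val w)).1 (theta_lift (fiber_pull w)).

(** Replacing (e, x) by the representative (e theta_x'(g), x') with x = g x'
replaces (x, e^-1 b) by its translate under g^-1, so the class of its image
under the equivariant map is unchanged. *)
Lemma bullet_sectionE (b : B) (w : fiber (tilde_alpha c) (sproj B b)) e x
    (p : pull_obj c B) :
  val w = sim e x -> val p = (x, e^-1 ** b) ->
  bullet_section w = ind_class c e (theta_lift p).
Proof.
move=> def_w def_p; apply/eqP/ind_classP.
have := @ind_reprP _ _ _ _ c (slice_top X) e x; rewrite -def_w.
case=> g []; rewrite slice_topE => def_x def_e; exists g.
split; last by rewrite (slice_homE theta_lift) mk_gmapE.
rewrite -(gmapE theta_lift); congr (theta_lift _).
apply: val_inj; rewrite def_p {1}def_x /= def_e; congr (_, _).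
by rewrite -gactM invMg mulKVg.
Qed.

Fact bullet_section_proj (b : B) :
  [forall w, sproj _ ([ffun w => @bullet_section b w] w) == val w].
Proof.
apply/forallP => w; rewrite ffunE !mk_gmapE ind_proj_funE slice_homE mk_gmapE.
by rewrite /= -ind_repr.
Qed.

Definition bullet_transpose_fun (b : B) : cell_bullet c A :=
  existT
    (partial_section (tilde_alpha c) (ind_obj c (theta_part_obj c A)))
    (sproj B b)
    (exist _ [ffun w => @bullet_section b w] (bullet_section_proj b)).

Fact bullet_transpose_equi h b :
  bullet_transpose_fun (h ** b) = h ** bullet_transpose_fun b.
Proof.
apply: Pi_eq => [|w w' eq_w]; first exact: gmapE.
rewrite /= !ffunE /= [RHS]ind_actE; apply: bullet_sectionE.
  (* h (h^-1 w') unfolds to the class whose first component is h times that of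
     the representative of h^-1 w'. *)
  by rewrite eq_w -[LHS](gact_invr h).
by rewrite /= invMg gactM gact_inv.
Qed.

Fact bullet_transpose_proj b :
  sproj (cell_bullet c A) (bullet_transpose_fun b) = sproj B b.
Proof. by rewrite mk_gmapE. Qed.

Definition bullet_transpose : slice_hom B (cell_bullet c A) :=
  mk_slice_hom bullet_transpose_equi bullet_transpose_proj.

Lemma bullet_transposeE b
    (w : fiber (tilde_alpha c) (tag (bullet_transpose b))) e x
    (p : pull_obj c B) :
  val w = sim e x -> val p = (x, e^-1 ** b) ->
  val (tagged (bullet_transpose b)) w = ind_class c e (theta_lift p).
Proof.
move: (bullet_transpose b) (mk_slice_homE bullet_transpose_equi
  bullet_transpose_proj b) w => _ -> w def_w def_p.
by rewrite /= ffunE; apply: bullet_sectionE def_p.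
Qed.

End Forward.

Section Backward.
Variable v : slice_hom B (cell_bullet c A).

Lemma bullet_hom_tag b : tag (v b) = sproj B b.
Proof. by rewrite -(slice_homE v) mk_gmapE. Qed.

Fact unit_fiber_subproof (p : pull_obj c B) :
  tilde_alpha c (sim 1 (val p).1) == tag (v (val p).2).
Proof. by rewrite mk_gmapE tilde_alpha_funE gact1 pull_eqP bullet_hom_tag. Qed.

Definition unit_fiber (p : pull_obj c B) :
    fiber (tilde_alpha c) (tag (v (val p).2)) :=
  exist _ (sim 1 (val p).1) (unit_fiber_subproof p).

(** The element a over x that an inverse transpose of v must take as its value
at (x, b): the partial section v b takes the value [1, a] at [1, x]. *)
Definition is_value_at (p : pull_obj c B) (a : theta_part_obj c A) : bool :=
  (sproj _ a == (val p).1)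
  && (val (tagged (v (val p).2)) (unit_fiber p) == ind_class c 1 a).

Lemma value_at_exists p : exists a, is_value_at p a.
Proof.
have proj_v := partial_sectionE (tagged (v (val p).2)) (unit_fiber p).
have [a a_x def_z] := ind_proj_lift proj_v.
by exists a; rewrite /is_value_at a_x def_z !eqxx.
Qed.

Lemma value_at_uniq p a a' : is_value_at p a -> is_value_at p a' -> a = a'.
Proof.
case/andP=> /eqP a_x /eqP def_a /andP[/eqP a'_x /eqP def_a'].
by apply: (@theta_part_ind_inj _ 1); rewrite ?a_x ?a'_x -?def_a -?def_a'.
Qed.

Definition value_at p : theta_part_obj c A := xchoose (value_at_exists p).

Lemma value_atP p : is_value_at p (value_at p).
Proof. exact: xchooseP. Qed.

(** Equivariance of v: its partial section at b, evaluated at [e, x], is e times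
the partial section at e^-1 b evaluated at [1, x]. *)
Lemma bullet_hom_value b (w : fiber (tilde_alpha c) (tag (v b))) e x
    (p : pull_obj c B) :
  val w = sim e x -> val p = (x, e^-1 ** b) ->
  val (tagged (v b)) w = ind_class c e (value_at p).
Proof.
move=> def_w def_p; have /andP[_ /eqP] := value_atP p.
have def_v : v b = e ** v (val p).2 by rewrite -(gmapE v) def_p gact_invr.
rewrite (Pi_act_val def_v (w := unit_fiber p)); last first.
  by rewrite def_w [RHS]ind_actE mulg1 def_p.
by move=> ->; rewrite [LHS]ind_actE mulg1.
Qed.

(** As [1, g x] = [theta_x(g), x], evaluating the partial section of
theta_x(g) b there gives theta_x(g) [1, a] = [theta_x(g), a] = [1, g a]. *)
Lemma value_at_equi g p : value_at (g ** p) = g ** value_at p.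
Proof.
apply: (@value_at_uniq (g ** p)); first exact: value_atP.
have /andP[/eqP a_x _] := value_atP p.
rewrite /is_value_at gmapE a_x eqxx /=.
rewrite (@bullet_hom_value _ _ (theta (val p).1 g) (val p).1 p) ?ind_class_act.
- by rewrite mul1g a_x.
- by rewrite /= (@ind_class_act (slice_top X)) slice_topE mul1g.
by rewrite /= gact_inv -surjective_pairing.
Qed.

Fact bullet_untranspose_equi g p :
  val (value_at (g ** p)) = g ** val (value_at p).
Proof. by rewrite value_at_equi. Qed.

Fact bullet_untranspose_proj p :
  sproj A (val (value_at p)) = sproj (pull_obj c B) p.
Proof.
by have /andP[/eqP a_x _] := value_atP p; rewrite mk_gmapE -a_x mk_gmapE.
Qed.

Definition bullet_untranspose : slice_hom (pull_obj c B) A :=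
  mk_slice_hom bullet_untranspose_equi bullet_untranspose_proj.

Lemma bullet_untransposeE p : bullet_untranspose p = val (value_at p).
Proof. exact: mk_slice_homE. Qed.

End Backward.

Lemma bullet_transposeK : cancel bullet_transpose bullet_untranspose.
Proof.
move=> u; apply: slice_hom_eq => p.
rewrite bullet_untransposeE -theta_lift_val; congr val.
apply: (value_at_uniq (value_atP _ p)).
rewrite /is_value_at slice_homE mk_gmapE eqxx /=.
apply/eqP/bullet_transposeE => //.
by rewrite invg1 gact1 -surjective_pairing.
Qed.

(** Stated for a fiber over any y equal to the image of b: the fibers met below
lie over the tag of an element of a dependent product, and this tag is only
propositionally that image. *)
Lemma fiber_pullP (b : B) y (w : fiber (tilde_alpha c) y) :
  y = sproj B b ->
  exists e x (p : pull_obj c B), val w = sim e x /\ val p = (x, e^-1 ** b).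
Proof.
move=> def_y; move: w; rewrite def_y => w.
exists (repr (val w)).1, (repr (val w)).2, (fiber_pull w).
by rewrite -ind_repr.
Qed.

Lemma bullet_untransposeK : cancel bullet_untranspose bullet_transpose.
Proof.
move=> v; apply: slice_hom_eq => b; apply: Pi_eq => [|w w' eq_w].
  by rewrite !bullet_hom_tag.
have [e [x [p [def_w def_p]]]] := fiber_pullP w (bullet_hom_tag _ b).
rewrite (bullet_transposeE def_w def_p) (bullet_hom_value _ def_p) -?eq_w //.
congr ind_class; apply: val_inj.
by rewrite theta_lift_val bullet_untransposeE.
Qed.

End Transpose.

Lemma bullet_transpose_nat (B B' : slice_obj Y) (A A' : slice_obj X)
    (h : slice_hom B' B) (u : slice_hom (pull_obj c B) A)
    (k : slice_hom A A') :
  bullet_transpose (slice_comp k (slice_comp u (pull_hom c h)))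
  = slice_comp (Pi_hom (tilde_alpha c) (ind_hom c (theta_part_hom c k)))
      (slice_comp (bullet_transpose u) h).
Proof.
apply: slice_hom_eq => b; apply: Pi_eq => [|w w' eq_w].
  by rewrite !bullet_hom_tag.
have [e [x [p [def_w def_p]]]] := fiber_pullP w (bullet_hom_tag _ b).
rewrite (bullet_transposeE def_w def_p).
move: w' eq_w; rewrite !slice_compE [Pi_hom _ _ _]mk_slice_homE => w' eq_w.
rewrite [RHS]ffunE.
rewrite (@bullet_transposeE _ _ u _ _ e x (pull_hom c h p)) -?eq_w //.
  rewrite [RHS]mk_slice_homE ind_funE; congr ind_class.
  apply: val_inj; rewrite theta_lift_val !slice_compE.
  by rewrite [theta_part_hom _ _ _]mk_slice_homE /= theta_lift_val.
by rewrite slice_simp /pull_fun /= def_p gmapE.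
Qed.

Lemma cell_star_bullet_adjunction :
  left_adjoint_to (cell_star c) (cell_bullet c).
Proof.
constructor.
apply: (@Adjunction _ _ (cell_star c) (cell_bullet c) bullet_transpose).
  by move=> B A; exists (@bullet_untranspose B A);
     [apply: bullet_transposeK | apply: bullet_untransposeK].
move=> B B' A A' h u k; exact: bullet_transpose_nat.
Qed.

End RightAdjoint.
End Cell.

Theorem proposition6p3 (G H : finGroupType) (X : gset G) (Y : gset H)
    (c : cell1 X Y) :
  left_adjoint_to (cell_plus c) (cell_star c) /\
  left_adjoint_to (cell_star c) (cell_bullet c).
Proof.
split; first exact: cell_plus_star_adjunction.
exact: cell_star_bullet_adjunction.
Qed.
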